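(* Let $g:[0,1]^2\to\mathbb{R}$ be symmetric (i.e. $g((x,y))=g((y,x))$ for all $(x,y)\in[0,1]^2$) and strictly increasing in both $x$ and $y$ (i.e. $g((x,y))>g((x',y))$ whenever $x>x'$ and $g((x,y))>g((x,y'))$ whenever $y>y'$). Consider the greedy algorithm that processes the points of a finite set $S\subset[0,1]^2$ containing the origin in any order in which $p$ is processed before $q$ whenever $g(p)>g(q)$. Then the worst-case approximation ratio of this algorithm is at most $3/4$; that is, $$\inf_{S}\frac{\mathrm{area}(R_{\mathrm{greedy}}(S))}{\mathrm{OPT}(S)}\le \frac34,$$ where the infimum is over all finite $S\subset[0,1]^2$ with $(0,0)\in S$, $R_{\mathrm{greedy}}(S)$ is the packing output by the algorithm, and $\mathrm{OPT}(S)$ is the maximum area of a lower-left anchored rectangle packing of $S$.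
   Context: $U=[0,1]^2$. For a point $p$, $x(p),y(p)$ are its coordinates. A rectangle is lower-left anchored at $p$ if it is an axis-parallel rectangle with lower-left corner $p$ (a point or segment counts as a degenerate rectangle of area $0$). A lower-left anchored rectangle packing (LLARP) of $S$ is a set of axis-parallel rectangles contained in $U$, pairwise interior-disjoint, with one rectangle lower-left anchored at each point of $S$, none containing a point of $S$ in its interior; its area is the area of the union of its rectangles. The greedy algorithm for a given processing order: start with $R=\emptyset$; for each point $p$ in the order, add to $R$ a maximum-area rectangle contained in $U$, lower-left anchored at $p$, interior-disjoint from the rectangles already in $R$ and containing no point of $S$ in its interior; return $R$. *)

(* Defs.v *)
From Stdlib Require Import Reals List Permutation.
Import ListNotations.
Open Scope R_scope.

Definition point := (R * R)%type.

Record rect := mkRect { rx1 : R; ry1 : R; rx2 : R; ry2 : R }.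

Definition in_U (p : point) : Prop :=
  0 <= fst p <= 1 /\ 0 <= snd p <= 1.

Definition rect_in_U (r : rect) : Prop :=
  0 <= rx1 r /\ rx1 r <= rx2 r /\ rx2 r <= 1 /\
  0 <= ry1 r /\ ry1 r <= ry2 r /\ ry2 r <= 1.

Definition in_interior (r : rect) (q : point) : Prop :=
  rx1 r < fst q < rx2 r /\ ry1 r < snd q < ry2 r.

Definition interior_disjoint (r1 r2 : rect) : Prop :=
  ~ (exists q, in_interior r1 q /\ in_interior r2 q).

Definition area (r : rect) : R := (rx2 r - rx1 r) * (ry2 r - ry1 r).

(* Area of a packing: sum of the areas of its pairwise interior-disjoint
   rectangles (= area of their union). *)
Definition total_area (P : list rect) : R :=
  fold_right (fun r acc => area r + acc) 0 P.

Definition anchored_at (p : point) (r : rect) : Prop :=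
  rx1 r = fst p /\ ry1 r = snd p.

Definition dummy_rect : rect := mkRect 0 0 0 0.

Definition is_LLARP (S : list point) (P : list rect) : Prop :=
  Forall2 anchored_at S P /\
  Forall rect_in_U P /\
  (forall i j, (i < length P)%nat -> (j < length P)%nat -> i <> j ->
     interior_disjoint (nth i P dummy_rect) (nth j P dummy_rect)) /\
  (forall r q, In r P -> In q S -> ~ in_interior r q).

Definition feasible (S : list point) (placed : list rect) (p : point) (r : rect) : Prop :=
  anchored_at p r /\ rect_in_U r /\
  Forall (interior_disjoint r) placed /\
  (forall q, In q S -> ~ in_interior r q).

Fixpoint greedy_from (S : list point) (placed : list rect)
    (ord : list point) (out : list rect) : Prop :=
  match ord, out with
  | nil, nil => True
  | p :: ord', r :: out' =>
      feasible S placed p r /\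
      (forall r', feasible S placed p r' -> area r' <= area r) /\
      greedy_from S (placed ++ [r]) ord' out'
  | _, _ => False
  end.

Definition dummy_point : point := (0, 0).

Definition order_respects (g : point -> R) (ord : list point) : Prop :=
  forall i j, (i < j)%nat -> (j < length ord)%nat ->
    ~ (g (nth j ord dummy_point) > g (nth i ord dummy_point)).

Definition greedy_run (g : point -> R) (S : list point) (Rs : list rect) : Prop :=
  exists ord, Permutation S ord /\ order_respects g ord /\ greedy_from S nil ord Rs.

Definition valid_input (S : list point) : Prop :=
  NoDup S /\ Forall in_U S /\ In (0, 0) S.

(* Main.v *)
Require Import Defs.
From Stdlib Require Import Reals List Permutation.
From Stdlib Require Import Sorted Lra Lia.
Import ListNotations.
Open Scope R_scope.

(** Nest the squares [[t,1]^2], [t = t_0 > t_1 > ...], in steps of [c = a + b]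
    with [a < b] and [b / a] close to 1.  The layer between the squares of
    corners [(t,t)] and [(t+c,t+c)] has the points
    [e = (t+c,t+a)], [p = (t+b,t)], [r = (t,t+a)], [o = (t,t)].
    Symmetry and monotonicity of [g] force the processing order, inner layers
    first and [e, p, r, o] inside a layer.  The tall rectangle
    [[t+b,t+c] x [t,1]] of [p] is slightly larger than the wide one
    [[t+b,1] x [t,t+a]], so greedy takes it and wastes [[t+c,1] x [t,t+a]];
    choosing the wide rectangles instead allows a perfect tiling of the unit
    square.  The waste is about [c / 2] times the sum of the sides of the squares,
    which tends to [1/4] as [c] tends to 0 and [b / a] to 1. *)

(** * Rectangles and lists of ordered pairs *)

Lemma overlap_not_interior_disjoint (r1 r2 : rect) :
  rx1 r1 < rx2 r1 -> rx1 r1 < rx2 r2 -> rx1 r2 < rx2 r1 -> rx1 r2 < rx2 r2 ->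
  ry1 r1 < ry2 r1 -> ry1 r1 < ry2 r2 -> ry1 r2 < ry2 r1 -> ry1 r2 < ry2 r2 ->
  ~ interior_disjoint r1 r2.
Proof.
  assert (between : forall u v x y, u < x -> u < y -> v < x -> v < y ->
            exists m, (u < m < x) /\ (v < m < y)).
  { intros u v x y H1 H2 H3 H4.
    (* The midpoint between the larger left end and the smaller right end. *)
    destruct (Rle_dec u v), (Rle_dec x y).
    - exists ((v + x) / 2); lra.
    - exists ((v + y) / 2); lra.
    - exists ((u + x) / 2); lra.
    - exists ((u + y) / 2); lra. }
  intros H1 H2 H3 H4 H5 H6 H7 H8 H; apply H.
  destruct (between (rx1 r1) (rx1 r2) (rx2 r1) (rx2 r2)) as [x Hx]; try assumption.
  destruct (between (ry1 r1) (ry1 r2) (ry2 r1) (ry2 r2)) as [y Hy]; try assumption.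
  exists (x, y); unfold in_interior; simpl; tauto.
Qed.

Lemma separated_interior_disjoint (r1 r2 : rect) :
  rx2 r1 <= rx1 r2 \/ rx2 r2 <= rx1 r1 \/ ry2 r1 <= ry1 r2 \/ ry2 r2 <= ry1 r1 ->
  interior_disjoint r1 r2.
Proof.
  intros H [q [Hq1 Hq2]]; unfold in_interior in *; lra.
Qed.

Lemma interior_disjoint_sym (r1 r2 : rect) :
  interior_disjoint r1 r2 -> interior_disjoint r2 r1.
Proof.
  intros H [q [H1 H2]]; apply H; exists q; tauto.
Qed.

Lemma ForallOrdPairs_app {T : Type} (Q : T -> T -> Prop) (l1 l2 : list T) :
  ForallOrdPairs Q l1 -> ForallOrdPairs Q l2 ->
  (forall x y, In x l1 -> In y l2 -> Q x y) ->
  ForallOrdPairs Q (l1 ++ l2).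
Proof.
  induction 1 as [|x l Hx Hl IH]; intros H2 H; simpl; [assumption|].
  constructor.
  - apply Forall_app; split; [assumption|].
    apply Forall_forall; intros y Hy; apply H; simpl; auto.
  - apply IH; [assumption|]; intros; apply H; simpl; auto.
Qed.

Lemma ForallOrdPairs_nth {T : Type} (Q : T -> T -> Prop) (d : T) (l : list T) :
  ForallOrdPairs Q l ->
  forall i j, (i < j < length l)%nat -> Q (nth i l d) (nth j l d).
Proof.
  induction 1 as [|x l Hx Hl IH]; intros i j Hij; simpl in Hij; [lia|].
  destruct j as [|j]; [lia|]; destruct i as [|i]; simpl.
  - rewrite Forall_forall in Hx; apply Hx, nth_In; lia.
  - apply IH; lia.
Qed.

Lemma nth_ForallOrdPairs {T : Type} (Q : T -> T -> Prop) (d : T) (l : list T) :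
  (forall i j, (i < j)%nat -> (j < length l)%nat -> Q (nth i l d) (nth j l d)) ->
  ForallOrdPairs Q l.
Proof.
  induction l as [|x l IH]; intros H; constructor.
  - apply Forall_forall; intros y Hy.
    destruct (In_nth l y d Hy) as [n [Hn <-]].
    apply (H 0%nat (S n)); simpl; lia.
  - apply IH; intros i j Hij Hj; apply (H (S i) (S j)); simpl; lia.
Qed.

(** Strict decrease leaves no ties. The head of [l] strictly exceeds every other entry, so anywhere
    but at the head of [l'] it would follow an entry of smaller value; hence the heads agree, and so
    on. This identifies every [g]-compatible order with a given decreasing one. *)
Lemma Permutation_decreasing_eq {T : Type} (g : T -> R) (l l' : list T) :
  ForallOrdPairs (fun p q => g q < g p) l ->
  ForallOrdPairs (fun p q => ~ g q > g p) l' ->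
  Permutation l l' -> l = l'.
Proof.
  intros Hl; revert l'; induction Hl as [|x l Hx Hl IH]; intros l' Hl' HP.
  - symmetry; now apply Permutation_nil.
  - destruct Hl' as [|y l' Hy Hl'].
    + now apply Permutation_sym, Permutation_nil in HP.
    + assert (Hyx : y = x).
      { assert (Hy' : In y (x :: l))
          by (apply (Permutation_in _ (Permutation_sym HP)); simpl; auto).
        assert (Hx' : In x (y :: l')) by (apply (Permutation_in _ HP); simpl; auto).
        destruct Hy' as [|Hy']; [now symmetry|].
        destruct Hx' as [|Hx']; [assumption|].
        rewrite Forall_forall in Hx, Hy.
        specialize (Hx _ Hy'); specialize (Hy _ Hx'); lra. }
      subst y; f_equal; apply IH; [assumption|].
      now apply Permutation_cons_inv in HP.
Qed.

Lemma ForallOrdPairs_decreasing_NoDup {T : Type} (g : T -> R) (l : list T) :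
  ForallOrdPairs (fun p q => g q < g p) l -> NoDup l.
Proof.
  induction 1 as [|x l Hx Hl IH]; constructor; [|assumption].
  intros Hin; rewrite Forall_forall in Hx; specialize (Hx _ Hin); lra.
Qed.

Lemma greedy_from_app (S : list point) (l1 l2 : list point) :
  forall placed out, greedy_from S placed (l1 ++ l2) out ->
  exists o1 o2, out = o1 ++ o2 /\ greedy_from S placed l1 o1 /\
    greedy_from S (placed ++ o1) l2 o2.
Proof.
  induction l1 as [|p l1 IH]; intros placed out H.
  - exists nil, out; rewrite app_nil_r; simpl; auto.
  - destruct out as [|r out]; [destruct H|].
    destruct H as [H1 [H2 H3]].
    destruct (IH _ _ H3) as [o1 [o2 [-> [H4 H5]]]].
    exists (r :: o1), o2; rewrite <- app_assoc in H5; simpl in *; auto.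
Qed.

Lemma total_area_app (P1 P2 : list rect) :
  total_area (P1 ++ P2) = total_area P1 + total_area P2.
Proof.
  induction P1 as [|r P1 IH]; simpl; [lra|].
  unfold total_area in *; simpl; rewrite IH; lra.
Qed.

(** * The layered point set *)

Section Construction.

Context (a b c : R) (Ha : 0 < a) (Hab : a < b) (Hc : c = a + b).

(** The shift by one gives the innermost square, [j = 0], the positive side [c]. *)
Definition corner (j : nat) : R := 1 - INR (S j) * c.

(** Listed in the order in which greedy has to process the points, so the same list serves as input
    and as order. *)
Fixpoint pts (j : nat) : list point :=
  match j with
  | O => [(corner 0, corner 0)]
  | S i =>
      let t := corner (S i) in
      pts i ++ [(t + c, t + a); (t + b, t); (t, t + a); (t, t)]
  end.

Fixpoint tiling (j : nat) : list rect :=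
  match j with
  | O => [mkRect (corner 0) (corner 0) 1 1]
  | S i =>
      let t := corner (S i) in
      tiling i ++ [mkRect (t + c) (t + a) 1 (t + c); mkRect (t + b) t 1 (t + a);
                   mkRect t (t + a) (t + c) 1; mkRect t t (t + b) (t + a)]
  end.

Lemma corner_0 : corner 0 = 1 - c.
Proof. unfold corner; simpl; lra. Qed.

Lemma corner_S (j : nat) : corner (S j) + c = corner j.
Proof. unfold corner; rewrite (S_INR (S j)); lra. Qed.

Lemma corner_le (i j : nat) : (i <= j)%nat -> corner j <= corner i.
Proof.
  induction 1 as [|j _ IH]; [lra|].
  generalize (corner_S j); lra.
Qed.

Lemma corner_le_sub (j : nat) : corner j <= 1 - c.
Proof. rewrite <- corner_0; apply corner_le; lia. Qed.

Lemma pts_bounds (j : nat) (q : point) :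
  In q (pts j) -> corner j <= fst q <= 1 /\ corner j <= snd q <= 1.
Proof.
  induction j as [|j IH]; intros H.
  - generalize corner_0; destruct H as [<-|[]]; simpl; lra.
  - generalize (corner_S j) (corner_le_sub j); intros H1 H2.
    simpl in H; apply in_app_or in H; destruct H as [H|H].
    + specialize (IH H); lra.
    + simpl in H.
      repeat destruct H as [<-|H]; try destruct H; simpl; lra.
Qed.

Lemma pts_incl (i j : nat) : (i <= j)%nat -> incl (pts i) (pts j).
Proof.
  induction 1 as [|j _ IH]; [apply incl_refl|].
  intros q Hq; simpl; apply in_or_app; auto.
Qed.

(** The open vertical strips between [t], [t + b] and [t + c], where [t = corner (S j)], contain no
    point of any layer. Rectangles inside such a strip therefore avoid all points whatever their
    height. *)
Lemma pts_layer_abscissa (j n : nat) (q : point) :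
  (S j <= n)%nat -> In q (pts n) ->
  fst q <= corner (S j) \/ fst q = corner (S j) + b \/ corner j <= fst q.
Proof.
  induction 1 as [|n Hn IH]; intros H;
    cbn [pts] in H; apply in_app_or in H; destruct H as [H|H].
  - apply pts_bounds in H; tauto.
  - generalize (corner_S j); intros H1.
    simpl in H.
    repeat destruct H as [<-|H]; try destruct H; cbn [fst]; lra.
  - auto.
  - left; generalize (corner_S n) (corner_le _ _ Hn); intros H1 H2.
    simpl in H.
    repeat destruct H as [<-|H]; try destruct H; cbn [fst]; lra.
Qed.

Lemma pts_abscissa_le (n : nat) (q : point) :
  In q (pts n) -> fst q <= corner 0.
Proof.
  induction n as [|n IH]; intros H.
  - destruct H as [<-|[]]; simpl; lra.
  - cbn [pts] in H; apply in_app_or in H; destruct H as [H|H]; [auto|].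
    generalize (corner_S n) (corner_le 0 n (Nat.le_0_l n)); intros H1 H2.
    simpl in H.
    repeat destruct H as [<-|H]; try destruct H; cbn [fst]; lra.
Qed.

(** * The perfect tiling *)

Lemma tiling_bounds (j : nat) (r : rect) :
  In r (tiling j) ->
  corner j <= rx1 r <= rx2 r /\ rx2 r <= 1 /\
  corner j <= ry1 r <= ry2 r /\ ry2 r <= 1.
Proof.
  induction j as [|j IH]; intros H.
  - generalize corner_0; destruct H as [<-|[]]; simpl; lra.
  - generalize (corner_S j) (corner_le_sub j); intros H1 H2.
    cbn [tiling] in H; apply in_app_or in H; destruct H as [H|H].
    + specialize (IH H); lra.
    + simpl in H.
      repeat destruct H as [<-|H]; try destruct H; cbn [rx1 rx2 ry1 ry2]; lra.
Qed.

Lemma tiling_anchored (j : nat) : Forall2 anchored_at (pts j) (tiling j).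
Proof.
  induction j as [|j IH]; cbn [pts tiling].
  - repeat constructor.
  - apply Forall2_app; [assumption|repeat constructor].
Qed.

Lemma tiling_avoids_pts (j : nat) (r : rect) (q : point) :
  In r (tiling j) -> In q (pts j) -> ~ in_interior r q.
Proof.
  unfold in_interior.
  induction j as [|j IH]; intros Hr Hq.
  - destruct Hr as [<-|[]], Hq as [<-|[]]; simpl; lra.
  - generalize (corner_S j) (corner_le_sub j); intros H1 H2.
    cbn [pts tiling] in Hr, Hq.
    apply in_app_or in Hr; apply in_app_or in Hq.
    destruct Hr as [Hr|Hr], Hq as [Hq|Hq].
    + auto.
    + apply tiling_bounds in Hr; simpl in Hq.
      repeat destruct Hq as [<-|Hq]; try destruct Hq; cbn [fst snd]; lra.
    + apply pts_bounds in Hq; simpl in Hr.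
      repeat destruct Hr as [<-|Hr]; try destruct Hr; cbn [rx1 rx2 ry1 ry2]; lra.
    + simpl in Hr, Hq.
      repeat destruct Hr as [<-|Hr]; try destruct Hr;
        repeat destruct Hq as [<-|Hq]; try destruct Hq;
        cbn [rx1 rx2 ry1 ry2 fst snd]; lra.
Qed.

Lemma tiling_disjoint (j : nat) : ForallOrdPairs interior_disjoint (tiling j).
Proof.
  induction j as [|j IH]; cbn [tiling].
  - repeat constructor.
  - generalize (corner_S j) (corner_le_sub j); intros H1 H2.
    apply ForallOrdPairs_app; [assumption| |].
    + repeat constructor; apply separated_interior_disjoint; simpl; lra.
    + intros x y Hx Hy; apply tiling_bounds in Hx.
      apply separated_interior_disjoint; simpl in Hy.
      repeat destruct Hy as [<-|Hy]; try destruct Hy; cbn [rx1 rx2 ry1 ry2]; lra.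
Qed.

Lemma tiling_area (j : nat) : total_area (tiling j) = (1 - corner j) ^ 2.
Proof.
  induction j as [|j IH].
  - unfold total_area, area; simpl; ring.
  - cbn [tiling]; rewrite total_area_app, IH, <- (corner_S j), Hc.
    unfold total_area, area; simpl; ring.
Qed.

Lemma tiling_is_LLARP (n : nat) : 0 <= corner n -> is_LLARP (pts n) (tiling n).
Proof.
  intros Hn; repeat split.
  - apply tiling_anchored.
  - apply Forall_forall; intros r Hr; apply tiling_bounds in Hr.
    unfold rect_in_U; lra.
  - intros i j Hi Hj Hij.
    destruct (Nat.lt_ge_cases i j).
    + apply ForallOrdPairs_nth; [apply tiling_disjoint|lia].
    + apply interior_disjoint_sym, ForallOrdPairs_nth; [apply tiling_disjoint|lia].
  - intros r q; apply tiling_avoids_pts.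
Qed.

(** * The forced processing order *)

Lemma pts_decreasing (g : point -> R) (n : nat) :
  (forall x y, 0 <= x <= 1 -> 0 <= y <= 1 -> g (x, y) = g (y, x)) ->
  (forall x x' y, 0 <= x <= 1 -> 0 <= x' <= 1 -> 0 <= y <= 1 ->
     x > x' -> g (x, y) > g (x', y)) ->
  (forall x y y', 0 <= x <= 1 -> 0 <= y <= 1 -> 0 <= y' <= 1 ->
     y > y' -> g (x, y) > g (x, y')) ->
  0 <= corner n ->
  ForallOrdPairs (fun p q => g q < g p) (pts n).
Proof.
  intros Hsym Hx Hy.
  assert (mono : forall x y x' y', 0 <= x' <= x -> x <= 1 -> 0 <= y' <= y -> y <= 1 ->
            x' < x \/ y' < y -> g (x', y') < g (x, y)).
  { intros x y x' y' H1 H2 H3 H4 H5.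
    destruct (Rlt_dec x' x) as [Hlt|Hge].
    - apply Rlt_le_trans with (g (x, y')); [apply Hx; lra|].
      destruct (Rlt_dec y' y); [left; apply Hy; lra|].
      replace y' with y by lra; lra.
    - replace x' with x by lra; apply Hy; lra. }
  induction n as [|n IH]; intros Hn.
  - repeat constructor.
  - generalize (corner_S n) (corner_le_sub n); intros H1 H2.
    cbn [pts]; apply ForallOrdPairs_app; [apply IH; lra| |].
    + repeat constructor; try (apply mono; lra).
      (* The points [p] and [r] of a layer are the only pair not ordered coordinatewise; reflecting
         one in the diagonal reduces their comparison to [a < b]. *)
      rewrite Hsym by lra; apply mono; lra.
    + intros [x y] q Hxy Hq; apply pts_bounds in Hxy; simpl in Hxy, Hq.
      repeat destruct Hq as [<-|Hq]; try destruct Hq; apply mono; lra.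
Qed.

(** * The choices of greedy within a layer *)

(** The point [e] forbids being both wide and tall: past abscissa [t + c] the height is at most [a]
    and the area at most [a * (1 - t - b)], below the area [a * (1 - t)] of the tall rectangle.
    Without crossing that abscissa, the tall rectangle is the unique maximum. *)
Lemma greedy_p_tall (n j : nat) (placed : list rect) (r : rect) :
  (S j <= n)%nat -> 0 <= corner n ->
  Forall (fun r' => corner j <= rx1 r') placed ->
  feasible (pts n) placed (corner (S j) + b, corner (S j)) r ->
  (forall r', feasible (pts n) placed (corner (S j) + b, corner (S j)) r' ->
     area r' <= area r) ->
  r = mkRect (corner (S j) + b) (corner (S j)) (corner j) 1.
Proof.
  intros Hj Hn Hpl [[E1 E2] [HU [_ Hav]]] Hmax.
  generalize (corner_S j) (corner_le_sub j) (corner_le _ _ Hj); intros H1 H2 H3.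
  set (t := corner (S j)) in *.
  assert (Hbig : a * (1 - t) <= area r).
  { replace (a * (1 - t)) with (area (mkRect (t + b) t (corner j) 1))
      by (unfold area; simpl; rewrite <- H1, Hc; ring).
    apply Hmax; repeat split; simpl; try lra.
    - eapply Forall_impl; [|exact Hpl].
      intros r' Hr'; apply separated_interior_disjoint; simpl in *; lra.
    - intros q Hq [Hqx _]; simpl in Hqx.
      destruct (pts_layer_abscissa _ _ _ Hj Hq) as [H|[H|H]]; fold t in H; lra. }
  assert (He : In (t + c, t + a) (pts n)).
  { apply (pts_incl _ _ Hj); cbn [pts]; apply in_or_app; right; left; reflexivity. }
  specialize (Hav _ He).
  destruct r as [x1 y1 x2 y2].
  unfold area, rect_in_U, in_interior in *; simpl in *; subst x1 y1.
  destruct (Rlt_dec (t + c) x2) as [Hwide|Hnarrow].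
  - assert (y2 <= t + a) by (apply Rnot_lt_le; intros ?; apply Hav; lra).
    exfalso; nra.
  - assert (Hy2 : y2 = 1) by nra.
    assert (Hx2 : x2 = corner j) by nra.
    now subst.
Qed.

(** The tall rectangle of [p] acts as a wall at abscissa [t + b], so the best choice fills the strip
    to its left up to the top of the unit square. *)
Lemma greedy_r_eq (n j : nat) (placed : list rect) (r : rect) :
  (S j <= n)%nat -> 0 <= corner n ->
  Forall (fun r' => corner (S j) + b <= rx1 r') placed ->
  In (mkRect (corner (S j) + b) (corner (S j)) (corner j) 1) placed ->
  feasible (pts n) placed (corner (S j), corner (S j) + a) r ->
  (forall r', feasible (pts n) placed (corner (S j), corner (S j) + a) r' ->
     area r' <= area r) ->
  r = mkRect (corner (S j)) (corner (S j) + a) (corner (S j) + b) 1.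
Proof.
  intros Hj Hn Hpl Hp [[E1 E2] [HU [Hdis _]]] Hmax.
  generalize (corner_S j) (corner_le_sub j) (corner_le _ _ Hj); intros H1 H2 H3.
  set (t := corner (S j)) in *.
  assert (Hbig : b * (1 - t - a) <= area r).
  { replace (b * (1 - t - a)) with (area (mkRect t (t + a) (t + b) 1))
      by (unfold area; simpl; ring).
    apply Hmax; repeat split; simpl; try lra.
    - eapply Forall_impl; [|exact Hpl].
      intros r' Hr'; apply separated_interior_disjoint; simpl in *; lra.
    - intros q Hq [Hqx _]; simpl in Hqx.
      destruct (pts_layer_abscissa _ _ _ Hj Hq) as [H|[H|H]]; fold t in H; lra. }
  rewrite Forall_forall in Hdis; specialize (Hdis _ Hp).
  destruct r as [x1 y1 x2 y2].
  unfold area, rect_in_U in *; simpl in *; subst x1 y1.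
  (* A degenerate rectangle has empty interior and is disjoint from everything; positive area has to
     be established before the wall can block. *)
  assert (t < x2) by nra.
  assert (t + a < y2) by nra.
  assert (x2 <= t + b).
  { apply Rnot_lt_le; intros ?; revert Hdis.
    apply overlap_not_interior_disjoint; simpl; lra. }
  assert (Hy2 : y2 = 1) by nra.
  assert (Hx2 : x2 = t + b) by nra.
  now subst.
Qed.

(** The rectangles of [p] and [r] confine this one to width [b] and height [a]. Nondegeneracy is
    recorded because this rectangle blocks the point [e] of the next layer out. *)
Lemma greedy_o_area (n j : nat) (placed : list rect) (r : rect) :
  (S j <= n)%nat -> 0 <= corner n ->
  Forall (fun r' => corner (S j) + b <= rx1 r' \/ corner (S j) + a <= ry1 r') placed ->
  In (mkRect (corner (S j) + b) (corner (S j)) (corner j) 1) placed ->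
  In (mkRect (corner (S j)) (corner (S j) + a) (corner (S j) + b) 1) placed ->
  feasible (pts n) placed (corner (S j), corner (S j)) r ->
  (forall r', feasible (pts n) placed (corner (S j), corner (S j)) r' ->
     area r' <= area r) ->
  area r = a * b /\ rx1 r < rx2 r /\ ry1 r < ry2 r.
Proof.
  intros Hj Hn Hpl Hp Hr [[E1 E2] [HU [Hdis _]]] Hmax.
  generalize (corner_S j) (corner_le_sub j) (corner_le _ _ Hj); intros H1 H2 H3.
  set (t := corner (S j)) in *.
  assert (Hbig : a * b <= area r).
  { replace (a * b) with (area (mkRect t t (t + b) (t + a)))
      by (unfold area; simpl; ring).
    apply Hmax; repeat split; simpl; try lra.
    - eapply Forall_impl; [|exact Hpl].
      intros r' Hr'; apply separated_interior_disjoint; simpl in *; lra.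
    - intros q Hq [Hqx _]; simpl in Hqx.
      destruct (pts_layer_abscissa _ _ _ Hj Hq) as [H|[H|H]]; fold t in H; lra. }
  rewrite Forall_forall in Hdis.
  generalize (Hdis _ Hp) (Hdis _ Hr); clear Hdis; intros Dp Dr.
  destruct r as [x1 y1 x2 y2].
  unfold area, rect_in_U in *; simpl in *; subst x1 y1.
  assert (0 < a * b) by nra.
  assert (t < x2) by nra.
  assert (t < y2) by nra.
  assert (x2 <= t + b).
  { apply Rnot_lt_le; intros ?; revert Dp.
    apply overlap_not_interior_disjoint; simpl; lra. }
  assert (y2 <= t + a).
  { apply Rnot_lt_le; intros ?; revert Dr.
    apply overlap_not_interior_disjoint; simpl; lra. }
  repeat split; try lra; nra.
Qed.

(** The inner square's corner [(corner j, corner j)] lies directly above [e], at distance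
    [c - a = b]. The nondegenerate rectangle anchored there caps the height at [b], and the width is
    at most the side of the inner square. *)
Lemma greedy_e_area (n j : nat) (placed : list rect) (r r' : rect) :
  In r' placed -> anchored_at (corner j, corner j) r' ->
  rx1 r' < rx2 r' -> ry1 r' < ry2 r' ->
  feasible (pts n) placed (corner (S j) + c, corner (S j) + a) r ->
  area r <= (1 - corner j) * b.
Proof.
  intros Hin [F1 F2] Hx Hy [[E1 E2] [HU [Hdis _]]].
  generalize (corner_S j) (corner_le_sub j); intros H1 H2.
  rewrite Forall_forall in Hdis; specialize (Hdis _ Hin).
  destruct r as [x1 y1 x2 y2].
  unfold area, rect_in_U in *; cbn [rx1 ry1 rx2 ry2 fst snd] in *; subst x1 y1.
  destruct (Rlt_dec (corner (S j) + c) x2).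
  - assert (y2 <= corner j).
    { apply Rnot_lt_le; intros ?; revert Hdis.
      apply overlap_not_interior_disjoint; cbn [rx1 ry1 rx2 ry2]; lra. }
    apply Rmult_le_compat; lra.
  - replace x2 with (corner (S j) + c) by lra.
    rewrite Rminus_diag, Rmult_0_l; apply Rmult_le_pos; lra.
Qed.

(** * Accumulating the waste over the layers *)

(** The run stops after [pts j], but all of [pts n] are obstacles from the start. The first
    invariant keeps the strips of the next layer free, and the second supplies the rectangle that
    caps its [e]. The area deficit sums the waste [a * c * (i + 1)] over [i < j]. *)
Lemma greedy_layers (n j : nat) (out : list rect) :
  (j <= n)%nat -> 0 <= corner n ->
  greedy_from (pts n) nil (pts j) out ->
  Forall (fun r => corner j <= rx1 r) out /\
  (exists r, In r out /\ anchored_at (corner j, corner j) r /\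
     rx1 r < rx2 r /\ ry1 r < ry2 r) /\
  total_area out <= (1 - corner j) ^ 2 - a * c * (INR j * (INR j + 1) / 2).
Proof.
  intros Hj Hn; revert out.
  induction j as [|j IH]; intros out H.
  - generalize (corner_le _ _ Hj) corner_0; intros H1 H2.
    destruct out as [|r [|? ?]]; simpl in H; try tauto.
    destruct H as [[[E1 E2] [HU _]] [Hmax _]].
    (* No point lies to the right of [corner 0], so the whole innermost square is available. *)
    assert (Hbig : (1 - corner 0) ^ 2 <= area r).
    { replace ((1 - corner 0) ^ 2) with (area (mkRect (corner 0) (corner 0) 1 1))
        by (unfold area; simpl; ring).
      apply Hmax; repeat split; simpl; try lra.
      - constructor.
      - intros q Hq [Hqx _]; simpl in Hqx; apply pts_abscissa_le in Hq; lra. }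
    destruct r as [x1 y1 x2 y2].
    unfold area, rect_in_U, total_area in *; cbn [rx1 ry1 rx2 ry2 fst snd fold_right] in *.
    subst x1 y1; simpl INR.
    assert (corner 0 < x2) by nra.
    assert (corner 0 < y2) by nra.
    repeat split.
    + constructor; [simpl; lra|constructor].
    + exists (mkRect (corner 0) (corner 0) x2 y2); repeat split; simpl; auto.
    + unfold area; cbn [rx1 ry1 rx2 ry2]; nra.
  - cbn [pts] in H; apply greedy_from_app in H.
    destruct H as [out' [l [-> [H Hl]]]].
    destruct (IH ltac:(lia) _ H) as [Hx [[q [Hq1 [Hq2 [Hq3 Hq4]]]] Harea]].
    clear IH H.
    destruct l as [|e [|p [|r [|o [|? ?]]]]]; simpl in Hl; try tauto.
    destruct Hl as [He [_ [Hp [Mp [Hr [Mr [Ho [Mo _]]]]]]]].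
    generalize (corner_S j); intros HS.
    assert (He1 : corner j <= rx1 e)
      by (destruct He as [[E _] _]; simpl in E; rewrite E; lra).
    apply (greedy_e_area n j _ e q Hq1 Hq2 Hq3 Hq4) in He.
    apply (greedy_p_tall n j) in Hp; try assumption;
      [|apply Forall_app; auto].
    subst p.
    assert (Hx' : Forall (fun r' => corner (S j) + b <= rx1 r') out')
      by (eapply Forall_impl; [|exact Hx]; simpl; intros; lra).
    apply (greedy_r_eq n j) in Hr; try assumption;
      [|repeat (apply Forall_app; split); try assumption;
        (apply Forall_cons; [simpl; lra|apply Forall_nil])
       |apply in_or_app; right; left; reflexivity].
    subst r.
    assert (Ho' : anchored_at (corner (S j), corner (S j)) o) by apply Ho.
    apply (greedy_o_area n j) in Ho; try assumption.
    2:{ repeat (apply Forall_app; split);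
          [eapply Forall_impl; [|exact Hx']; simpl; tauto| | |];
          (apply Forall_cons; [simpl; lra|apply Forall_nil]). }
    2:{ apply in_or_app; left; apply in_or_app; right; left; reflexivity. }
    2:{ apply in_or_app; right; left; reflexivity. }
    destruct Ho as [Ho1 [Ho2 Ho3]].
    repeat split.
    + apply Forall_app; split;
        [eapply Forall_impl; [|exact Hx]; simpl; intros; lra|].
      destruct Ho' as [E _]; simpl in E.
      repeat (apply Forall_cons; [simpl rx1; lra|]); apply Forall_nil.
    + exists o; repeat split; try assumption; try apply Ho'.
      apply in_or_app; right; simpl; auto.
    + rewrite total_area_app.
      unfold total_area at 2; cbn [fold_right].
      rewrite Ho1; unfold area at 2 3; cbn [rx1 ry1 rx2 ry2].
      (* The layer covers [2 c s - c^2] minus the waste [a (s - c)], where [s] is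
         the side of its square and [s - c = (j+1) c]. *)
      assert (Hs : 1 - corner j = (INR j + 1) * c)
        by (unfold corner; rewrite S_INR; ring).
      assert (HsS : corner (S j) = 1 - (INR j + 1) * c - c) by lra.
      rewrite S_INR.
      replace (corner j) with (1 - (INR j + 1) * c) in * by lra.
      rewrite HsS in *.
      set (u := INR j) in *.
      clear - He Harea Hc; subst c.
      nra.
Qed.

End Construction.

(** * Choice of parameters and the limit *)

Theorem theorem9 (g : point -> R)
  (Hsym : forall x y, 0 <= x <= 1 -> 0 <= y <= 1 -> g (x, y) = g (y, x))
  (Hincx : forall x x' y, 0 <= x <= 1 -> 0 <= x' <= 1 -> 0 <= y <= 1 ->
             x > x' -> g (x, y) > g (x', y))
  (Hincy : forall x y y', 0 <= x <= 1 -> 0 <= y <= 1 -> 0 <= y' <= 1 ->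
             y > y' -> g (x, y) > g (x, y'))
  (* any (deterministic) greedy algorithm processing the points in a g-compatible order *)
  (A : list point -> list rect)
  (HA : forall S, valid_input S -> greedy_run g S (A S)) :
  forall eps, 0 < eps ->
    exists S, valid_input S /\
      exists P, is_LLARP S P /\ total_area (A S) <= (3 / 4 + eps) * total_area P.
Proof.
  intros eps Heps.
  destruct (INR_unbounded (/ eps)) as [n0 Hn0].
  (* A successor, so that [x >= 1] makes [a] positive and the origin is the point [o] of the
     outermost layer. *)
  set (n := S n0); set (x := INR n).
  assert (Hx1 : 1 <= x) by (unfold x, n; rewrite S_INR; generalize (pos_INR n0); lra).
  assert (Hxe : 1 <= eps * x).
  { assert (/ eps < x) by (unfold x, n; rewrite S_INR; lra).
    apply Rmult_le_reg_l with (/ eps); [now apply Rinv_0_lt_compat|].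
    rewrite <- Rmult_assoc, Rinv_l, Rmult_1_r, Rmult_1_l; lra. }
  (* This makes the outermost corner [corner c n] the origin. *)
  set (c := / (x + 1)).
  assert (Hc0 : 0 < c) by (apply Rinv_0_lt_compat; lra).
  (* The factor [d] normalizes the ratio [b / a = (x + 1) / x] so that [a + b = c]. *)
  set (d := / (2 * x + 1)).
  assert (Hd0 : 0 < d) by (apply Rinv_0_lt_compat; lra).
  set (a := c * x * d); set (b := c * (x + 1) * d).
  assert (Hcx : c * (x + 1) = 1) by (unfold c; field; lra).
  assert (Hdx : d * (2 * x + 1) = 1) by (unfold d; field; lra).
  assert (Hcd : 0 < c * d) by nra.
  assert (Ha : 0 < a) by (unfold a; nra).
  assert (Hab : a < b) by (unfold a, b; nra).
  assert (Hc : c = a + b).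
  { unfold a, b; transitivity (c * (d * (2 * x + 1))); [rewrite Hdx; ring|ring]. }
  assert (Hcorner : corner c n = 0)
    by (unfold corner; rewrite S_INR; fold x; lra).
  assert (Hdec : ForallOrdPairs (fun p q => g q < g p) (pts a b c n))
    by (apply pts_decreasing; try assumption; lra).
  assert (Hvalid : valid_input (pts a b c n)).
  { repeat split.
    - eapply ForallOrdPairs_decreasing_NoDup; exact Hdec.
    - apply Forall_forall; intros q Hq.
      apply pts_bounds in Hq; try assumption.
      unfold in_U; lra.
    - rewrite <- Hcorner; unfold n; cbn [pts].
      apply in_or_app; right; simpl; auto. }
  exists (pts a b c n); split; [assumption|].
  exists (tiling a b c n); split; [apply tiling_is_LLARP; try assumption; lra|].
  (* The competing packing has area 1, so the total area of greedy is itself the ratio to bound. *)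
  rewrite tiling_area by assumption; rewrite Hcorner.
  destruct (HA _ Hvalid) as [ord [Hperm [Hord Hgr]]].
  assert (Eord : pts a b c n = ord).
  { apply (Permutation_decreasing_eq g); try assumption.
    apply nth_ForallOrdPairs with (d := dummy_point); exact Hord. }
  rewrite <- Eord in Hgr.
  destruct (greedy_layers a b c Ha Hab Hc n n _ (le_n n) ltac:(lra) Hgr)
    as [_ [_ Harea]].
  rewrite Hcorner in Harea; fold x in Harea.
  apply Rle_trans with (1 := Harea).
  assert (E : a * c * (x * (x + 1) / 2) = x * x * d * c / 2).
  { unfold a; transitivity (x * x * d * c / 2 * (c * (x + 1))); [field|rewrite Hcx; ring]. }
  rewrite E.
  (* The total waste is [x^2 / (2 (x + 1) (2 x + 1))]; its gap to 1/4 is of order [1 / x], hence at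
     most [eps] because [1 <= eps * x]. *)
  assert (E2 : 1 / 4 - x * x * d * c / 2 = (3 * x + 1) / (4 * (x + 1) * (2 * x + 1)))
    by (unfold c, d; field; lra).
  assert (E3 : (3 * x + 1) / (4 * (x + 1) * (2 * x + 1)) <= eps).
  { apply Rmult_le_reg_r with (4 * (x + 1) * (2 * x + 1)); [nra|].
    unfold Rdiv; rewrite Rmult_assoc, Rinv_l, Rmult_1_r by nra.
    nra. }
  lra.
Qed.
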